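(* Let $a,b,d\in\mathbb{N}$ (nonnegative integers) with $0\le b<a$ and $0\le d\le b/2$. Then the zonal polynomial coefficient indexed by the partitions $(a,a-b)$ and $(a-d,a-b+d)$ of $2a-b$ is $$c_{(a,a-b),(a-d,a-b+d)}=\frac{(2a-b)!\,\left(b+\frac12\right)\,\left(\frac12\right)_{d}}{d!\,(a-b)!\,(b-d)!\,\left(b-d+\frac12\right)_{a-b+d+1}}.$$
   Context: Pochhammer symbol: $(x)_m:=x(x+1)\cdots(x+m-1)$ for integers $m\geq 1$, and $(x)_0:=1$. Partitions: $\mathcal{P}_n$ is the set of integer partitions of $n$, i.e. tuples $\lambda=(\lambda_1,\ldots,\lambda_k)$ of integers with $\lambda_1\ge\cdots\ge\lambda_k\ge 1$ and $\lambda_1+\cdots+\lambda_k=n$. They are ordered lexicographically: $\kappa>\lambda$ iff for some $l$ one has $\kappa_1=\lambda_1,\ldots,\kappa_{l-1}=\lambda_{l-1}$ and $\kappa_l>\lambda_l$. Put $\rho_\lambda:=\sum_{i=1}^{k}\lambda_i(\lambda_i-i)$. Monomial symmetric functions: for $\lambda\in\mathcal{P}_n$ and variables $y_1,\ldots,y_q$, $M_\lambda(y_1,\ldots,y_q)$ is the sum of all distinct monomials obtained from $y_1^{\lambda_1}\cdots y_k^{\lambda_k}$ by permuting the variables (and $M_\lambda=0$ if $q<k$). Zonal polynomials and their coefficients: take $q\geq n$ variables $y_1,\dots,y_q$ (the coefficients do not depend on $q$). The zonal polynomials $\mathcal{C}_\kappa$, $\kappa\in\mathcal{P}_n$, are the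 symmetric homogeneous polynomials of degree $n$ of the form $\mathcal{C}_\kappa=\sum_{\lambda\le\kappa}c_{\kappa,\lambda}M_\lambda$ (with $c_{\kappa,\lambda}=0$ for $\lambda<\kappa$ with $\rho_\kappa\le\rho_\lambda$) that are eigenfunctions $$\Delta_Y\,\mathcal{C}_\kappa=(\rho_\kappa+(q-1)n)\,\mathcal{C}_\kappa,\qquad \Delta_Y=\sum_{i=1}^{q}\Big(y_i^2\frac{\partial^2}{\partial y_i^2}+\sum_{j\ne i}\frac{y_i^2}{y_i-y_j}\frac{\partial}{\partial y_i}\Big),$$ normalized by $\sum_{\kappa\in\mathcal{P}_n}\mathcal{C}_\kappa=(y_1+\cdots+y_q)^n$. The numbers $c_{\kappa,\lambda}$ are the zonal polynomial coefficients (with $c_{\kappa,\lambda}=0$ for $\lambda>\kappa$). Equivalently, the $c_{\kappa,\lambda}$ are determined recursively as follows. For $\lambda<\kappa$ with $\rho_\kappa>\rho_\lambda$, $$c_{\kappa,\lambda}=\sum_{(r,s,t)}\frac{(\lambda_r+t)-(\lambda_s-t)}{\rho_\kappa-\rho_\lambda}\,c_{\kappa,\mu},$$ the sum being over all $r<s$ and $1\le t\le\lambda_s$ such that the partition $\mu$, obtained from $\lambda$ by replacing $\lambda_r$ by $\lambda_r+t$ and $\lambda_s$ by $\lambda_s-t$ and sorting in descending order (dropping zeros), satisfies $\lambda<\mu\le\kappa$. For $\lambda<\kappa$ with $\rho_\kappa\le\rho_\lambda$, $c_{\kappa,\lambda}=0$. The diagonal entries are determined by $\sum_{\kappa\ge\lambda}c_{\kappa,\lambda}=\frac{n!}{\lambda_1!\cdots\lambda_k!}$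 for every $\lambda\in\mathcal{P}_n$; in particular $c_{(n),(n)}=1$. *)

(* Defs.v *)
From mathcomp Require Import all_boot all_order all_algebra all_fingroup.
From mathcomp Require Export fraction mpoly.

Set Implicit Arguments.
Unset Strict Implicit.
Unset Printing Implicit Defensive.

Import Order.TTheory GRing.Theory Num.Theory.
Local Open Scope ring_scope.

Definition pochhammer (R : pzSemiRingType) (x : R) (m : nat) : R :=
  \prod_(i < m) (x + i%:R).

Definition is_partition (n : nat) (la : seq nat) : bool :=
  [&& sorted geq la, all (leq 1) la & sumn la == n].

(* A partition of n has at most n parts, each at most n. *)
Definition partitions (n : nat) : seq (seq nat) :=
  [seq la <- [seq map val s | s : n.-bseq 'I_n.+1] | is_partition n la].

Lemma partitions_uniq n : uniq (partitions n).
Proof.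
rewrite filter_uniq // map_inj_uniq ?enum_uniq // => s t.
by move=> /(inj_map val_inj) /val_inj.
Qed.

Lemma mem_partitions n la : (la \in partitions n) = is_partition n la.
Proof.
rewrite mem_filter andb_idr // => /and3P[_ la_gt0 /eqP la_n].
have size_la : (size la <= n)%N.
  rewrite -{}la_n; elim: la la_gt0 => //= x s IHs /andP[x_gt0 /IHs].
  exact: leq_add x_gt0.
have le_la : all (fun i => i < n.+1)%N la.
  apply/allP => i; rewrite ltnS -la_n; elim: {la_gt0 la_n size_la} la => //= x s.
  move=> IHs; rewrite inE => /predU1P[-> | /IHs]; first exact: leq_addr.
  by move=> /leq_trans; apply; apply: leq_addl.
pose s := map (@inord n) la.
have size_s : (size s <= n)%N by rewrite size_map.
apply/mapP; exists (Bseq size_s); first by rewrite mem_enum.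
rewrite /= -map_comp map_id_in // => i /(allP le_la) /= lt_i.
exact: inordK.
Qed.

(* Two distinct partitions of the same n are never prefixes of each other, so
   on partitions of n the convention of [seqlexi] on prefixes plays no role. *)
Definition lex_lt (la ka : seq nat) : bool :=
  ((la : seqlexi nat) < (ka : seqlexi nat))%O.
Definition lex_le (la ka : seq nat) : bool :=
  ((la : seqlexi nat) <= (ka : seqlexi nat))%O.

(* Parts are indexed from 0 here, hence the shift i.+1. *)
Definition rho (la : seq nat) : int :=
  \sum_(i < size la) (nth 0%N la i)%:Z * ((nth 0%N la i)%:Z - i.+1%:Z).

Notation "x %:F" := (tofrac x) : ring_scope.

Section Zonal.

Variable R : realFieldType.

Definition monomial_symmetric (q : nat) (la : seq nat) : {mpoly R[q]} :=
  if (size la <= q)%N then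
    \sum_(m <- undup [seq [multinom nth 0%N la (s i) | i < q] | s : 'S_q])
      'X_[m]
  else 0.

(* The coefficients 'X_i^2 / ('X_i - 'X_j) are not polynomials, so the operator
   takes its values in the field of rational functions. *)
Definition Delta (q : nat) (p : {mpoly R[q]}) : {fraction {mpoly R[q]}} :=
  \sum_(i < q)
    (('X_i ^+ 2 * p^`M(i)^`M(i))%:F +
     \sum_(j < q | j != i)
       ('X_i ^+ 2)%:F / ('X_i - 'X_j)%:F * (p^`M(i))%:F).

Definition zonal_polynomial (n q : nat) (c : seq nat -> seq nat -> R)
    (ka : seq nat) : {mpoly R[q]} :=
  \sum_(la <- partitions n | lex_le la ka) c ka la *: monomial_symmetric q la.

Record zonal_coefficients (n q : nat) (c : seq nat -> seq nat -> R) : Prop := {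
  zonal_upper : forall ka la, is_partition n ka -> is_partition n la ->
    lex_lt ka la -> c ka la = 0;
  zonal_rho : forall ka la, is_partition n ka -> is_partition n la ->
    lex_lt la ka -> rho ka <= rho la -> c ka la = 0;
  zonal_eigen : forall ka, is_partition n ka ->
    Delta (zonal_polynomial n q c ka) =
    (((rho ka + (q%:Z - 1) * n%:Z)%:~R : R) *:
       zonal_polynomial n q c ka)%:F;
  zonal_sum : \sum_(ka <- partitions n) zonal_polynomial n q c ka =
    (\sum_(i < q) 'X_i) ^+ n
}.

End Zonal.

(* Main.v *)
Require Import Defs.
From mathcomp Require Import all_boot all_order all_algebra all_fingroup.
From mathcomp Require Import ring lra zify.

Set Implicit Arguments.
Unset Strict Implicit.
Unset Printing Implicit Defensive.

Import Order.TTheory GRing.Theory Num.Theory.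
Local Open Scope ring_scope.

(** Write [n = 2a - b] and let [p_j] be the coefficient of [y_0^(n-j) y_1^j] in a
zonal polynomial [C_kappa]; when [2j <= n] it is [c_(kappa, (n-j, j))].

Only these coefficients matter, because the eigenvalue equation closes on them.
For a symmetric [p], grouping the terms of [Delta p] by unordered pairs of
variables produces the divided differences
[Q_kl = (y_k^2 d_k p - y_l^2 d_l p) / (y_k - y_l)], which are polynomials.  At a
monomial in which [y_k] or [y_l] does not occur, the coefficient of [Q_kl] is
just a multiple of the coefficient of [p] itself.  At a monomial in [y_0] and
[y_1] every pair other than [(0, 1)] is of this kind, so the eigenvalue equation
determines the coefficients of [Q_01] there ([mcoeff_eigenfunction]); comparing
coefficients in [(y_0 - y_1) Q_01 = y_0^2 d_0 p - y_1^2 d_1 p] then gives a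
two-term recurrence between [p_j] and [p_(j+1)]
([zonal_coefficient_recurrence]).

The recurrence has two consequences.  First, [p_j] vanishes unless [kappa] is
one of [(n), (n-1, 1), ..., (n-j, j)]; in particular it vanishes when
[kappa] has at least three parts ([zonal_coefficient_two_part_eq0]).  Secondly,
for [kappa = (n-i, i)] the coefficients [p_i, p_(i+1), ...] are proportional to
those of the homogenized Legendre polynomial of degree [b = n - 2i]
([zonal_coefficient_legendre]).

There remain the diagonal coefficients.  Comparing coefficients in
[sum_kappa C_kappa = (y_0 + ... + y_(q-1))^n] gives, for [2j <= n],
[sum_(i <= j) c_((n-i, i), (n-j, j)) = binomial n j], a triangular system for
them.  That the announced values solve it is a terminating very-well-poised
hypergeometric summation, proved by creative telescoping in [j]
([sum_legendre_term]). *)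

(** * Divided differences of symmetric polynomials *)

Section Coefficients.

Variables (R : comNzRingType) (q : nat).
Implicit Types (p Q : {mpoly R[q]}) (i j : 'I_q) (m : 'X_{1..q}).

Lemma sub_mpolyXU_neq0 i j : i != j -> 'X_i - 'X_j != 0 :> {mpoly R[q]}.
Proof.
move=> ij; rewrite subr_eq0; apply: contra_neq ij => /(congr1 (mcoeff U_(j))).
rewrite !mcoeffXU eqxx; case: eqVneq => // _ /eqP.
by rewrite eq_sym oner_eq0.
Qed.

Lemma mcoeff_mulXU p i m : ('X_i * p)@_(m + U_(i)) = p@_m.
Proof. by rewrite mulrC addmC mcoeffMX. Qed.

Lemma mcoeff_mulXU0 p i m : m i = 0%N -> ('X_i * p)@_m = 0.
Proof.
move=> mi0; elim/mpolyind: p => [|c k p _ _ IHp]; first by rewrite mulr0 mcoeff0.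
rewrite mulrDr mcoeffD IHp addr0 -scalerAr mcoeffZ -mpolyXD mcoeffX.
have [km|_] := eqVneq; last by rewrite mulr0.
by move: mi0; rewrite -km mnmDE mnm1E eqxx.
Qed.

(** Euler's operator [y_i d_i] is diagonal in the monomial basis, and every
differential operator in [Delta] is built from it. *)
Lemma mcoeff_mulX_mderiv p i m : ('X_i * p^`M(i))@_m = p@_m *+ m i.
Proof.
have [mi0|mi_gt0] := posnP (m i); first by rewrite mi0 mcoeff_mulXU0.
have le_m : (U_(i) <= m)%MM.
  by apply/mnm_lepP => j; rewrite mnm1E; case: eqP => // <-.
rewrite -{1 2}(submK le_m) mcoeff_mulXU mcoeff_mderiv mnmBE mnm1E eqxx.
by rewrite subn1 prednK // submK.
Qed.

Lemma mcoeff_mulX2_mderiv p i m :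
  ('X_i ^+ 2 * p^`M(i))@_(m + U_(i)) = p@_m *+ m i.
Proof. by rewrite expr2 -mulrA mcoeff_mulXU mcoeff_mulX_mderiv. Qed.

Lemma mcoeff_mulX2_mderiv0 p i m : m i = 0%N -> ('X_i ^+ 2 * p^`M(i))@_m = 0.
Proof. by move=> mi0; rewrite expr2 -mulrA mcoeff_mulXU0. Qed.

Lemma mcoeff_mulX2_mderiv2 p i m :
  ('X_i ^+ 2 * p^`M(i)^`M(i))@_m = (m i)%:R * ((m i)%:R - 1) * p@_m.
Proof.
have -> : 'X_i ^+ 2 * p^`M(i)^`M(i) =
    'X_i * ('X_i * p^`M(i))^`M(i) - 'X_i * p^`M(i).
  rewrite mderivM mderivX mnm1E eqxx scale1r.
  have -> : (U_(i) - U_(i))%MM = 0%MM :> 'X_{1..q}.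
    by apply/mnmP => j; rewrite mnmBE subnn mnm0E.
  by rewrite mpolyX0; ring.
rewrite mcoeffB !mcoeff_mulX_mderiv -[_ *+ m i *+ m i]mulr_natr.
by rewrite -[p@_m *+ m i]mulr_natr; ring.
Qed.

Lemma msym_mpolyXU (s : 'S_q) i : msym s 'X_i = 'X_(s i) :> {mpoly R[q]}.
Proof.
rewrite msymX; congr 'X_[_]; apply/mnmP => j; rewrite mnmE !mnm1E.
by rewrite -(inj_eq (@perm_inj _ s)) permKV.
Qed.

Lemma mderiv_msym (s : 'S_q) p i : msym s p^`M(i) = (msym s p)^`M(s i).
Proof.
apply/mpolyP => m; rewrite mcoeff_sym !mcoeff_mderiv mcoeff_sym mnmE.
congr (p@_ _ *+ _); apply/mnmP => j.
by rewrite !(mnmE, mnmDE, mnm1E) (inj_eq perm_inj).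
Qed.

(** Modulo ['X_i - 'X_j] the exchange of ['X_i] and ['X_j] is the identity: this
holds on variables, hence on the ring they generate. *)
Lemma dvd_sub_msym_tperm i j p :
  exists Q, ('X_i - 'X_j) * Q = p - msym (tperm i j) p.
Proof.
elim/mpolyind: p => [|c m p _ _ [Q defQ]].
  by exists 0; rewrite msym0 mulr0 subr0.
suff [Q' defQ'] : exists Q',
    ('X_i - 'X_j) * Q' = 'X_[m] - msym (tperm i j) 'X_[m] :> {mpoly R[q]}.
  exists (c *: Q' + Q); rewrite mulrDr defQ -scalerAr defQ' msymD msymZ scalerBr.
  by ring.
rewrite (mpolyXE_id _ m); elim/big_rec: _ => [|k p' _ [Q1 defQ1]].
  by exists 0; rewrite msym1 mulr0 subrr.
suff [Q2 defQ2] : exists Q2, ('X_i - 'X_j) * Q2 =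
    'X_k ^+ m k - msym (tperm i j) ('X_k ^+ m k) :> {mpoly R[q]}.
  exists (Q2 * p' + msym (tperm i j) ('X_k ^+ m k) * Q1).
  transitivity (('X_i - 'X_j) * Q2 * p' +
      msym (tperm i j) ('X_k ^+ m k) * (('X_i - 'X_j) * Q1)); first by ring.
  by rewrite defQ2 defQ1 msymM; ring.
elim: (m k) => [|e [Q3 defQ3]].
  by exists 0; rewrite !expr0 msym1 mulr0 subrr.
suff [Q4 defQ4] : exists Q4, ('X_i - 'X_j) * Q4 =
    'X_k - msym (tperm i j) 'X_k :> {mpoly R[q]}.
  exists (Q4 * 'X_k ^+ e + msym (tperm i j) 'X_k * Q3).
  transitivity (('X_i - 'X_j) * Q4 * 'X_k ^+ e +
      msym (tperm i j) 'X_k * (('X_i - 'X_j) * Q3)); first by ring.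
  by rewrite defQ4 defQ3 !exprS msymM; ring.
rewrite msym_mpolyXU; case: tpermP => [->|->|_ _].
- by exists 1; rewrite mulr1.
- by exists (-1); ring.
- by exists 0; rewrite mulr0 subrr.
Qed.

(** When [p] is symmetric, exchanging ['X_i] and ['X_j] turns the first term into
the second. *)
Lemma dvd_sub_mulX2_mderiv i j p : p \is mpoly.symmetric ->
  exists Q, ('X_i - 'X_j) * Q = 'X_i ^+ 2 * p^`M(i) - 'X_j ^+ 2 * p^`M(j).
Proof.
move=> /issymP symp; have [Q defQ] := dvd_sub_msym_tperm i j ('X_i ^+ 2 * p^`M(i)).
exists Q; rewrite defQ; congr (_ - _).
by rewrite expr2 !msymM msym_mpolyXU mderiv_msym symp tpermL.
Qed.

(** Multiplying a monomial free of ['X_j] by ['X_i] leaves it free of ['X_j], so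
neither ['X_j * Q] nor ['X_j ^+ 2 * p^`M(j)] contributes to the coefficient at
[m + U_(i)]. *)
Lemma mcoeff_divided_difference i j p Q m : i != j -> m j = 0%N ->
    ('X_i - 'X_j) * Q = 'X_i ^+ 2 * p^`M(i) - 'X_j ^+ 2 * p^`M(j) ->
  Q@_m = p@_m *+ m i.
Proof.
move=> ij mj0 /(congr1 (mcoeff (m + U_(i)))).
have m'j0 : (m + U_(i))%MM j = 0%N by rewrite mnmDE mj0 mnm1E (negbTE ij).
rewrite mulrBl !mcoeffB mcoeff_mulXU mcoeff_mulX2_mderiv.
by rewrite mcoeff_mulXU0 // mcoeff_mulX2_mderiv0 // !subr0.
Qed.

End Coefficients.

(** * Eigenfunctions of the Laplacian *)

Section Eigenfunctions.

Variables (R : realFieldType) (q : nat).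
Implicit Types (p Q : {mpoly R[q]}) (i j : 'I_q) (m : 'X_{1..q}).

(** The sum over ordered pairs is counted twice, once in each order, so that every
individual pair contributes a divided difference. *)
Lemma Delta_double p (Q : 'I_q -> 'I_q -> {mpoly R[q]}) :
    (forall i j, i != j ->
       ('X_i - 'X_j) * Q i j = 'X_i ^+ 2 * p^`M(i) - 'X_j ^+ 2 * p^`M(j)) ->
  Delta p *+ 2 = ((\sum_i 'X_i ^+ 2 * p^`M(i)^`M(i)) *+ 2 +
                  \sum_i \sum_(j | j != i) Q i j)%:F.
Proof.
move=> defQ; rewrite /Delta big_split /= mulrnDl tofracD tofracMn.
rewrite [X in _ = X *+ 2 + _]raddf_sum; congr (_ + _); rewrite mulr2n.
rewrite [X in X + _](exchange_big_dep xpredT) //= -big_split [RHS]raddf_sum /=.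
apply: eq_bigr => i _; rewrite [RHS]raddf_sum /=.
rewrite [X in X + _](eq_bigl (fun j => j != i)); last first.
  by move=> j; rewrite eq_sym.
rewrite -big_split; apply: eq_bigr => j ji /=.
have Xij : ('X_i - 'X_j)%:F != 0 :> {fraction {mpoly R[q]}}.
  by rewrite tofrac_eq0 sub_mpolyXU_neq0 // eq_sym.
apply: (mulfI Xij); rewrite -[RHS]tofracM defQ 1?eq_sym //.
rewrite [RHS]tofracB [X in _ = X - _]tofracM [X in _ = _ - X]tofracM.
rewrite -(opprB 'X_i 'X_j) [(- _)%:F]tofracN.
move: (_ - _)%:F ('X_i ^+ 2)%:F ('X_j ^+ 2)%:F (p^`M(i)%:F) (p^`M(j)%:F) Xij.
move=> x y z u v x0; rewrite invrN mulrN mulNr mulrDr mulrN !mulrA.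
by rewrite ![x * _]mulrC !mulfK // addrC.
Qed.

(** At a monomial in ['X_i] and ['X_j], all divided differences other than that of
the pair [{i, j}] are known multiples of the coefficient of [p]; the eigenvalue
equation solves for the remaining one. *)
Lemma mcoeff_eigenfunction p (e : R) i j : i != j ->
    p \is mpoly.symmetric -> Delta p = (e *: p)%:F ->
  exists2 Q, ('X_i - 'X_j) * Q = 'X_i ^+ 2 * p^`M(i) - 'X_j ^+ 2 * p^`M(j) &
    forall a b, Q@_(U_(i) *+ a + U_(j) *+ b) =
      (e - (q%:R - 2) * (a + b)%:R - a%:R * (a%:R - 1) - b%:R * (b%:R - 1)) *
      p@_(U_(i) *+ a + U_(j) *+ b).
Proof.
move=> ij symp eigp.
have /fin_all_exists[Q defQ] : forall kl : 'I_q * 'I_q, exists Q,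
    ('X_(kl.1) - 'X_(kl.2)) * Q =
    'X_(kl.1) ^+ 2 * p^`M(kl.1) - 'X_(kl.2) ^+ 2 * p^`M(kl.2).
  by move=> kl; apply: dvd_sub_mulX2_mderiv.
exists (Q (i, j)); first exact: (defQ (i, j)).
move=> a b; set m := (_ + _)%MM.
have mi : m i = a.
  by rewrite mnmDE !mulmnE !mnm1E eqxx eq_sym (negbTE ij) mul1n mul0n addn0.
have mj : m j = b by rewrite mnmDE !mulmnE !mnm1E eqxx (negbTE ij) mul1n mul0n.
have m0 k : k != i -> k != j -> m k = 0%N.
  move=> ki kj; rewrite mnmDE !mulmnE !mnm1E ![_ == k]eq_sym.
  by rewrite (negbTE ki) (negbTE kj) !mul0n.
have defQ' k l : k != l -> ('X_k - 'X_l) * Q (k, l) =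
    'X_k ^+ 2 * p^`M(k) - 'X_l ^+ 2 * p^`M(l) by move=> _; apply: (defQ (k, l)).
have Qswap : Q (j, i) = Q (i, j).
  apply: (mulfI (sub_mpolyXU_neq0 R ij)); rewrite defQ' // -opprB mulNr.
  by rewrite (defQ' j i) 1?eq_sym // opprB.
have Qm k l : k != l -> (k != i) && (k != j) || (l != i) && (l != j) ->
    (Q (k, l))@_m = p@_m * (m k + m l)%:R.
  move=> kl /orP[] /andP[i' j']; rewrite (m0 _ i' j') mulr_natr ?addn0.
    apply: (@mcoeff_divided_difference _ _ l k); [by rewrite eq_sym | exact: m0 |].
    by rewrite -opprB mulNr defQ' // opprB.
  apply: (@mcoeff_divided_difference _ _ k l) => //; [exact: m0 | exact: defQ'].
have := Delta_double defQ'; rewrite eigp -tofracMn => /eqP.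
rewrite tofrac_eq => /eqP/(congr1 (mcoeff m)).
rewrite mcoeffMn mcoeffZ mcoeffD mcoeffMn.
have sumD2 : \sum_k ('X_k ^+ 2 * p^`M(k)^`M(k))@_m =
    (a%:R * (a%:R - 1) + b%:R * (b%:R - 1)) * p@_m.
  rewrite (bigD1 i) //= (bigD1 j) 1?eq_sym //= big1 => [|k /andP[ki kj]].
    by rewrite !mcoeff_mulX2_mderiv2 mi mj addr0 mulrDl.
  by rewrite mcoeff_mulX2_mderiv2 m0 // !mul0r.
(* Replace each Q (k, l) by its value away from the pair {i, j}; that pair occurs
   in both orders, hence the correction counted twice. *)
have sumQ : \sum_k \sum_(l | l != k) (Q (k, l))@_m =
    \sum_k \sum_(l | l != k) p@_m * (m k + m l)%:R +
    ((Q (i, j))@_m - p@_m * (a + b)%:R) *+ 2.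
  apply/eqP; rewrite addrC -subr_eq -sumrB; apply/eqP.
  under eq_bigr do rewrite -sumrB.
  rewrite pair_big_dep /= (bigD1 (i, j)) 1?eq_sym //=.
  rewrite (bigD1 (j, i)) /=; last by rewrite ij xpair_eqE negb_and eq_sym ij.
  rewrite big1 ?addr0 => [|[k l] /= /andP[/andP[lk kl_ij] kl_ji]].
    by rewrite Qswap mi mj [(b + a)%N]addnC.
  rewrite Qm ?subrr 1?eq_sym // -!negb_or -negb_and.
  apply/negP => /andP[/pred2P kij /pred2P lij].
  by case: kij lij lk kl_ij kl_ji => -> [] ->; rewrite ?eqxx.
have degm : \sum_k (m k)%:R = (a + b)%:R :> R.
  rewrite (bigD1 i) //= (bigD1 j) 1?eq_sym //= big1 => [|k /andP[ki kj]].
    by rewrite mi mj addr0 natrD.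
  by rewrite m0.
have sumdeg : \sum_k \sum_(l | l != k) p@_m * (m k + m l)%:R =
    p@_m * (2 * (q%:R - 1) * (a + b)%:R) :> R.
  under eq_bigr => k _.
    rewrite -mulr_sumr; under eq_bigr do rewrite natrD.
    rewrite big_split /= sumr_const cardC1 card_ord.
    have -> : \sum_(l | l != k) (m l)%:R = (a + b)%:R - (m k)%:R :> R.
      by rewrite -degm [in RHS](bigD1 k) //= addrC addrK.
    have -> : (m k)%:R *+ q.-1 = (m k)%:R * (q%:R - 1) :> R.
      have -> : q%:R = q.-1%:R + 1 :> R by rewrite natr1 (ltn_predK (ltn_ord k)).
      rewrite addrK.
      by rewrite mulr_natr.
    over.
  rewrite -mulr_sumr; congr (_ * _); rewrite big_split /= -mulr_suml degm.
  rewrite sumrB degm sumr_const card_ord -[_ *+ q]mulr_natr; ring.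
rewrite [X in X *+ 2 + _]raddf_sum /= sumD2 [X in _ + X]raddf_sum /=.
under [X in _ + X]eq_bigr do rewrite raddf_sum /=.
rewrite sumQ sumdeg => eq2.
lra.
Qed.

End Eigenfunctions.

Section Recurrence.

Variables (R : realFieldType) (q : nat).
Implicit Types (p : {mpoly R[q]}) (i j : 'I_q).

(** Initial condition of the recurrence below: at a power of ['X_i] the divided
difference of the pair [(i, j)] is known as well. *)
Lemma eigenfunction_mcoeff_row p (e : R) i j a : i != j ->
    p \is mpoly.symmetric -> Delta p = (e *: p)%:F ->
  (e - (q%:R - 2) * a%:R - a%:R ^+ 2) * p@_(U_(i) *+ a + U_(j) *+ 0) = 0.
Proof.
move=> ij symp eigp; have [Q defQ Qm] := mcoeff_eigenfunction ij symp eigp.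
have m0 : (U_(i) *+ a + U_(j) *+ 0)%MM j = 0%N.
  by rewrite mnmDE !mulmnE !mnm1E (negbTE ij) mul0n muln0.
have := Qm a 0%N; rewrite (mcoeff_divided_difference ij m0 defQ).
rewrite mnmDE !mulmnE !mnm1E eqxx mul1n muln0 !addn0 -mulr_natr.
move: (p@_ _) => x /eqP; rewrite -subr_eq0 => /eqP eq_x.
by rewrite -[RHS]oppr0 -eq_x; ring.
Qed.

(** Compare coefficients at ['X_i ^+ a.+1 * 'X_j ^+ b.+1] in
[('X_i - 'X_j) * Q = 'X_i ^+ 2 * p^`M(i) - 'X_j ^+ 2 * p^`M(j)]. *)
Lemma eigenfunction_mcoeff_recurrence p (e : R) i j a b : i != j ->
    p \is mpoly.symmetric -> Delta p = (e *: p)%:F ->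
  let e' := e - (q%:R - 2) * (a + b + 1)%:R in
  (e' - a%:R ^+ 2 - b%:R * (b%:R + 1)) * p@_(U_(i) *+ a + U_(j) *+ b.+1) =
  (e' - a%:R * (a%:R + 1) - b%:R ^+ 2) * p@_(U_(i) *+ a.+1 + U_(j) *+ b).
Proof.
move=> ij symp eigp e'; have [Q defQ Qm] := mcoeff_eigenfunction ij symp eigp.
set m := (U_(i) *+ a + U_(j) *+ b)%MM.
have mi : m i = a.
  by rewrite mnmDE !mulmnE !mnm1E eqxx eq_sym (negbTE ij) mul1n mul0n addn0.
have mj : m j = b by rewrite mnmDE !mulmnE !mnm1E eqxx (negbTE ij) mul1n mul0n.
have defi : (U_(i) *+ a.+1 + U_(j) *+ b = m + U_(i))%MM.
  by rewrite mulmS -addmA addmC.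
have defj : (U_(i) *+ a + U_(j) *+ b.+1 = m + U_(j))%MM.
  by rewrite mulmSr addmA.
have := congr1 (mcoeff (m + U_(i) + U_(j))) defQ.
have mC : (m + U_(i) + U_(j) = m + U_(j) + U_(i))%MM.
  by rewrite -!addmA [(U_(i) + _)%MM]addmC.
rewrite mulrBl !mcoeffB mcoeff_mulX2_mderiv mcoeff_mulXU.
rewrite mC mcoeff_mulX2_mderiv mcoeff_mulXU.
rewrite ![(m + _)%MM _]mnmDE !mnm1E [j == i]eq_sym (negbTE ij) mi mj !addn0.
rewrite -defi -defj !Qm.
move: p@_(_ + _ *+ b) p@_(_ + _ *+ b.+1) => x y.
rewrite /e' -[x *+ b]mulr_natr -[y *+ a]mulr_natr addn1 addnS addSn -!natr1 natrD.
move=> eq_xy; lra.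
Qed.

Lemma mcoeff_power_sum i j a b : i != j ->
  ((\sum_k 'X_k : {mpoly R[q]}) ^+ (a + b))@_(U_(i) *+ a + U_(j) *+ b) =
  'C(a + b, b)%:R.
Proof.
move=> ij.
have step n m : ((\sum_k 'X_k : {mpoly R[q]}) ^+ n.+1)@_m =
    \sum_k ('X_k * (\sum_k 'X_k) ^+ n)@_m.
  by rewrite exprS mulr_suml raddf_sum.
have mE a' b' k : (U_(i) *+ a' + U_(j) *+ b')%MM k =
    ((i == k) * a' + (j == k) * b')%N by rewrite mnmDE !mulmnE !mnm1E.
elim: a b => [|a IHa].
  elim=> [|b]; last rewrite !add0n !binn => IHb.
    by rewrite expr0 bin0 !mulm0n addm0 mcoeff1 eqxx.
  rewrite step (bigD1 j) //= [X in _ + X]big1 => [|k kj].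
    by rewrite mulmSr addmA mcoeff_mulXU IHb addr0.
  by rewrite mcoeff_mulXU0 // mE [j == k]eq_sym (negbTE kj) muln0.
elim=> [|b IHb].
  rewrite addn0 bin0 step (bigD1 i) //= [X in _ + X]big1 => [|k ki].
    rewrite mulmS -addmA addmC mcoeff_mulXU.
    by have := IHa 0%N; rewrite addn0 bin0 => ->; rewrite addr0.
  by rewrite mcoeff_mulXU0 // mE [i == k]eq_sym (negbTE ki) muln0.
rewrite addnS step (bigD1 i) //= [X in _ + X](bigD1 j) 1?eq_sym //=.
rewrite [X in _ + (_ + X)]big1 => [|k /andP[ki kj]].
  have di : (U_(i) *+ a.+1 + U_(j) *+ b.+1 =
      U_(i) *+ a + U_(j) *+ b.+1 + U_(i))%MM by rewrite mulmS -addmA addmC.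
  have dj : (U_(i) *+ a.+1 + U_(j) *+ b.+1 =
      U_(i) *+ a.+1 + U_(j) *+ b + U_(j))%MM by rewrite -addmA -mulmSr.
  rewrite {1}di mcoeff_mulXU dj mcoeff_mulXU IHb addSnnS IHa.
  by rewrite addr0 -natrD -[(a + b.+1).+1]addSn binS.
by rewrite mcoeff_mulXU0 // mE ![_ == k]eq_sym (negbTE ki) (negbTE kj).
Qed.

End Recurrence.

(** * A hypergeometric summation *)

Section Sum.

Variable R : realFieldType.
Implicit Types (x : R) (b d i j k m n : nat).

Lemma pochhammer0 x : pochhammer x 0 = 1.
Proof. exact: big_ord0. Qed.

Lemma pochhammerSr x n : pochhammer x n.+1 = pochhammer x n * (x + n%:R).
Proof. exact: big_ord_recr. Qed.

Lemma pochhammerSl x n : pochhammer x n.+1 = x * pochhammer (x + 1) n.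
Proof.
rewrite /pochhammer big_ord_recl addr0; congr (_ * _); apply: eq_bigr => i _.
by rewrite /= /bump add1n -addrA nat1r.
Qed.

Lemma pochhammer_gt0 x n : 0 < x -> 0 < pochhammer x n.
Proof. by move=> x_gt0; apply: prodr_gt0 => i _; rewrite ltr_wpDr. Qed.

(** This is the claimed value of [c_((n-i, i), (n-j, j)) / n!] for [n = j + m].  As a
function of [j] with [n] and [i] fixed, it is proportional to the coefficients of
the homogenized Legendre polynomial of degree [n - 2i], whose generating function
is [((1 - x t) (1 - y t)) ^ (-1/2)]. *)
Definition legendre_term j m i : R :=
  pochhammer 2%:R^-1 (j - i) * ((j - i)%:R + (m - i)%:R + 2%:R^-1) /
  ((j - i)`!%:R * i`!%:R * (m - i)`!%:R *
   pochhammer ((m - i)%:R + 2%:R^-1) j.+1).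

Lemma legendre_term_gt0 j m i : 0 < legendre_term j m i.
Proof.
have dm_ge0 := ler0n R (m - i); have dj_ge0 := ler0n R (j - i).
have ? : 0 < pochhammer (2%:R^-1 : R) (j - i) by apply: pochhammer_gt0; lra.
have ? : 0 < pochhammer ((m - i)%:R + 2%:R^-1 : R) j.+1.
  by apply: pochhammer_gt0; lra.
by apply: divr_gt0; rewrite !mulr_gt0 ?ltr0n ?fact_gt0 //; lra.
Qed.

(** The certificate of the summation of [legendre_term j m i] over [i].  The factor
[k%:R] makes it vanish at [k = 0]. *)
Definition telescoper j m k : R :=
  - (k%:R * pochhammer 2%:R^-1 (j.+1 - k)) /
  ((j.+1 - k)`!%:R * k`!%:R * (m - k)`!%:R *
   pochhammer ((m - k)%:R + 2%:R^-1 + 1) j.+1).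

Lemma legendre_term_telescopes j m k : (k <= j < m)%N ->
  j.+1%:R * legendre_term j.+1 m k - legendre_term j m k =
  telescoper j m k.+1 - telescoper j m k.
Proof.
case/andP=> kj jm; have [r ->] : exists r, j = (k + r)%N.
  by exists (j - k)%N; rewrite subnKC.
have [l ->] : exists l, m = (k + l).+1 by exists (m - k).-1; lia.
rewrite /legendre_term /telescoper.
have -> : ((k + r).+1 - k.+1 = r)%N by lia.
have -> : ((k + l).+1 - k.+1 = l)%N by lia.
have -> : ((k + r).+1 - k = r.+1)%N by lia.
have -> : ((k + l).+1 - k = l.+1)%N by lia.
have -> : (k + r - k = r)%N by lia.
set h : R := 2%:R^-1; pose y : R := l%:R + h + 1.
have -> : l.+1%:R + h = y by rewrite /y -natr1; ring.
rewrite -/y !(pochhammerSr _ (k + r).+1) (pochhammerSl y) (pochhammerSr (y + 1)).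
rewrite (pochhammerSr h) !factS !natrM.
have y_gt0 : 0 < y by rewrite /y /h; have := ler0n R l; lra.
have : 0 < pochhammer (y + 1) (k + r) by apply: pochhammer_gt0; lra.
have : 0 < y + (k + r)%:R + 1 by have := ler0n R (k + r); lra.
have h2 : h * 2 = 1 by rewrite mulVf ?pnatr_eq0.
have {h2 y_gt0} : 0 < y by [].
have := ler0n R k; have := ler0n R r; have := ler0n R l.
have : 0 < r`!%:R :> R by rewrite ltr0n fact_gt0.
have : 0 < k`!%:R :> R by rewrite ltr0n fact_gt0.
have : 0 < l`!%:R :> R by rewrite ltr0n fact_gt0.
move: (pochhammer h r) (pochhammer (y + 1) (k + r)) => p P.
rewrite /y -!natr1 !natrD /h.
move: (r`!%:R) (k`!%:R) (l`!%:R) (r%:R : R) (k%:R : R) (l%:R : R).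
move=> fr fk fl x z w fl0 fk0 fr0 w0 x0 z0 y0 yS0 P0.
field; do !(apply/andP; split); apply: lt0r_neq0 => //; lra.
Qed.

(** By telescoping, [j`! * \sum_i legendre_term j m i] does not depend on [j <= m]: the
partial sums up to [j] leave [telescoper j m j.+1], which cancels the extra term
[i = j.+1]. *)
Lemma sum_legendre_term j m : (j <= m)%N ->
  \sum_(i < j.+1) legendre_term j m i = (j`!%:R * m`!%:R)^-1.
Proof.
elim: j => [|j IHj] le_jm.
  rewrite big_ord1 /legendre_term subnn subn0 !pochhammerSr !pochhammer0.
  have := ler0n R m; have : 0 < m`!%:R :> R by rewrite ltr0n fact_gt0.
  rewrite fact0; move: (m%:R : R) (m`!%:R : R) => x y y0 x0.
  by field; do !(apply/andP; split); apply: lt0r_neq0 => //; lra.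
have tele k : (k <= j.+1)%N ->
    \sum_(i < k) (j.+1%:R * legendre_term j.+1 m i - legendre_term j m i) =
    telescoper j m k.
  elim: k => [|k IHk] le_kj; first by rewrite big_ord0 /telescoper !mul0r oppr0 mul0r.
  rewrite big_ord_recr /= {}IHk 1?ltnW // legendre_term_telescopes.
    by rewrite addrC subrK.
  by rewrite -ltnS le_kj.
have := tele _ (leqnn _); rewrite sumrB IHj ?(ltnW le_jm) // -mulr_sumr => eq_j.
rewrite big_ord_recr /=; apply: (@mulfI _ j.+1%:R); first by rewrite pnatr_eq0.
rewrite mulrDr; move/(canRL (subrK _)): eq_j => ->.
have -> : j.+1%:R * legendre_term j.+1 m j.+1 = - telescoper j m j.+1.
  rewrite /legendre_term /telescoper !subnn pochhammer0 fact0 add0r !mulr1 !mul1r.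
  rewrite pochhammerSl mulNr opprK; have x_ge0 := ler0n R (m - j.+1).
  have : 0 < pochhammer ((m - j.+1)%:R + 2%:R^-1 + 1 : R) j.+1.
    by apply: pochhammer_gt0; lra.
  have : 0 < j.+1`!%:R :> R by rewrite ltr0n fact_gt0.
  have : 0 < (m - j.+1)`!%:R :> R by rewrite ltr0n fact_gt0.
  move: (pochhammer _ _) (_`!%:R) (_`!%:R) => P fj fm fm0 fj0 P0.
  by field; do !(apply/andP; split); apply: lt0r_neq0 => //; lra.
rewrite addrAC subrr add0r factS natrM -mulrA [in RHS]invfM mulVKf //.
by rewrite pnatr_eq0.
Qed.

(** Keeping [j + m] fixed while [j] grows is the direction of the recurrence for
zonal coefficients, hence the shift from [m.+1] to [m]. *)
Lemma legendre_term_ratio j m i : (i <= j < m)%N ->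
  legendre_term j.+1 m i * ((j - i).+1%:R * (2 * (m.+1 - i)%:R - 1)) =
  legendre_term j m.+1 i * ((2 * (j - i)%:R + 1) * (m.+1 - i)%:R).
Proof.
case/andP=> le_ij lt_jm; rewrite /legendre_term !subSn //; last by lia.
move: (j - i)%N (m - i)%N => d b.
rewrite pochhammerSr pochhammerSl.
have -> : b%:R + 2%:R^-1 + 1 = b.+1%:R + 2%:R^-1 :> R by rewrite -natr1; ring.
have b_ge0 := ler0n R b; have d_ge0 := ler0n R d.
have : 0 < pochhammer (b.+1%:R + 2%:R^-1 : R) j.+1.
  by apply: pochhammer_gt0; rewrite -natr1; lra.
rewrite !factS !natrM -!natr1.
have : 0 < d`!%:R :> R by rewrite ltr0n fact_gt0.
have : 0 < b`!%:R :> R by rewrite ltr0n fact_gt0.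
have : 0 < i`!%:R :> R by rewrite ltr0n fact_gt0.
move: (pochhammer _ _) (pochhammer _ _) => p P fi fb fd P0.
field; do !(apply/andP; split); apply: lt0r_neq0 => //; lra.
Qed.

End Sum.

(** * Coefficients of zonal polynomials *)

Section ZonalCoefficients.

Variable R : realFieldType.
Implicit Types (n q j : nat) (la mu ka : seq nat).

Definition exponent q mu : 'X_{1..q} := [multinom nth 0%N mu i | i < q].

Lemma filter_gt0_mkseq_nth q mu : (size mu <= q)%N -> all (leq 1) mu ->
  [seq x <- mkseq (nth 0%N mu) q | (0 < x)%N] = mu.
Proof.
elim: mu q => [|x mu IHmu] q.
  move=> _ _; rewrite /mkseq (@eq_map _ _ _ (fun=> 0%N)) => [|i]; last exact: nth_nil.
  by elim: (iota 0 q).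
case: q => //= q le_mu /andP[x_gt0 mu_gt0].
rewrite x_gt0 (iotaDl 1 0) -map_comp; congr (_ :: _).
exact: IHmu.
Qed.

(** The exponents of a monomial determine its partition: drop the zeros and sort. *)
Lemma exponent_perm_eq q n la mu (s : 'S_q) : is_partition n la -> is_partition n mu ->
    (size la <= q)%N -> (size mu <= q)%N ->
  [multinom nth 0%N la (s i) | i < q] = exponent q mu -> la = mu.
Proof.
move=> /and3P[sla pla _] /and3P[smu pmu _] qla qmu eq_m.
apply: (sorted_eq (leT := geq)) => //.
- by move=> x y z yx xz; exact: leq_trans xz yx.
- by move=> x y /andP[yx xy]; apply/eqP; rewrite eqn_leq; apply/andP.
rewrite -(filter_gt0_mkseq_nth qla) // -(filter_gt0_mkseq_nth qmu) //.
apply: perm_filter.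
have -> : mkseq (nth 0%N mu) q =
    [seq nth 0%N la i | i <- [seq val i | i <- [seq s i | i <- enum 'I_q]]].
  rewrite /mkseq -val_enum_ord -!map_comp; apply: eq_map => i /=.
  by have := congr1 (fun m : 'X_{1..q} => m i) eq_m; rewrite !mnmE.
rewrite /mkseq -val_enum_ord; do 2!apply: perm_map.
apply: uniq_perm; rewrite ?enum_uniq //.
  by rewrite map_inj_uniq ?enum_uniq //; exact: perm_inj.
by move=> i; rewrite mem_enum -[i](permKV s) map_f // mem_enum.
Qed.

Lemma mcoeff_sum_undup_X q (l : seq 'X_{1..q}) m :
  (\sum_(m' <- undup l) 'X_[m'] : {mpoly R[q]})@_m = (m \in l)%:R.
Proof.
rewrite raddf_sum /= -mem_undup.
have [m_l|m_l] := boolP (m \in undup l).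
  rewrite (bigD1_seq m) ?undup_uniq //= mcoeffX eqxx big1 ?addr0 // => k km.
  by rewrite mcoeffX (negbTE km).
rewrite big_seq big1 // => k k_l; rewrite mcoeffX; case: eqP => // km.
by rewrite -km k_l in m_l.
Qed.

Lemma mcoeff_monomial_symmetric q n la mu : is_partition n la -> is_partition n mu ->
    (size mu <= q)%N ->
  (monomial_symmetric R q la)@_(exponent q mu) = (la == mu)%:R.
Proof.
move=> pla pmu qmu; rewrite /monomial_symmetric.
case: ifPn => qla; last first.
  by rewrite mcoeff0; case: eqP => // la_mu; rewrite la_mu qmu in qla.
rewrite mcoeff_sum_undup_X; congr _%:R; congr nat_of_bool.
apply/mapP/eqP => [[s _ eq_m]|->].
  exact: (exponent_perm_eq pla pmu _ _ (esym eq_m)).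
by exists 1%g; rewrite ?mem_enum //; apply/mnmP => i; rewrite !mnmE perm1.
Qed.

Lemma monomial_symmetric_sym q la : monomial_symmetric R q la \is mpoly.symmetric.
Proof.
apply/issymP => s; rewrite /monomial_symmetric; case: ifP; last by rewrite msym0.
move=> _; apply/mpolyP => m; rewrite mcoeff_sym !mcoeff_sum_undup_X.
congr _%:R; congr nat_of_bool; apply/mapP/mapP => [[t _ eq_m]|[t _ ->]].
  exists (s^-1 * t)%g; rewrite ?mem_enum //; apply/mnmP => i.
  have := congr1 (fun m : 'X_{1..q} => m (s^-1 i)%g) eq_m.
  by rewrite /= !mnmE permKV permM.
by exists (s * t)%g; rewrite ?mem_enum //; apply/mnmP => i; rewrite !mnmE permM.
Qed.

Variables (n q : nat) (c : seq nat -> seq nat -> R).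
Hypothesis hc : zonal_coefficients n q c.

Lemma zonal_polynomial_sym ka : zonal_polynomial n q c ka \is mpoly.symmetric.
Proof. by apply: rpred_sum => la _; apply/rpredZ/monomial_symmetric_sym. Qed.

(** For [mu] above [ka] both sides vanish: on the left because the sum stops at
[ka], on the right by triangularity. *)
Lemma mcoeff_zonal_polynomial ka mu : is_partition n ka -> is_partition n mu ->
    (size mu <= q)%N ->
  (zonal_polynomial n q c ka)@_(exponent q mu) = c ka mu.
Proof.
move=> pka pmu qmu; rewrite /zonal_polynomial raddf_sum /=.
have [le_mu|lt_ka] := boolP (lex_le mu ka).
  rewrite (big_rem mu) ?mem_partitions //= le_mu mcoeffZ.
  rewrite (mcoeff_monomial_symmetric pmu pmu) // eqxx mulr1.
  rewrite rem_filter ?partitions_uniq // big_filter_cond big_seq_cond big1 ?addr0 //.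
  move=> la /and3P[]; rewrite mem_partitions => pla la_mu _.
  by rewrite mcoeffZ (mcoeff_monomial_symmetric pla pmu) // (negbTE la_mu) mulr0.
rewrite big_seq_cond big1 => [|la /andP[]].
  by rewrite (zonal_upper hc) // /lex_lt ltNge.
rewrite mem_partitions => pla le_la.
rewrite mcoeffZ (mcoeff_monomial_symmetric pla pmu) //.
by case: eqP le_la lt_ka => [->->|_ _ _]; rewrite ?mulr0.
Qed.

End ZonalCoefficients.

(** * Partitions with at most two parts *)

(** Parts of a partition are positive, so [j = 0] stands for the partition [(n)]. *)
Definition two_part n j : seq nat :=
  if j is 0 then [:: n] else [:: (n - j)%N; j].

Lemma two_part_is_partition n j : (0 < n)%N -> (2 * j <= n)%N ->
  is_partition n (two_part n j).
Proof.
case: j => [|j] n0 le_jn; rewrite /is_partition /= ?n0 ?addn0 ?eqxx //.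
by apply/and3P; split; lia.
Qed.

Lemma size_two_part n j : (size (two_part n j) <= 2)%N.
Proof. by case: j. Qed.

Lemma two_part_inj n : injective (two_part n).
Proof. by move=> [|i] [|j] //= [_ ->]. Qed.

Lemma rho_two_part n j : (2 * j <= n)%N ->
  rho (two_part n j) =
  (n%:Z - j%:Z) * (n%:Z - j%:Z - 1) + j%:Z * (j%:Z - 2).
Proof.
case: j => [|j] le_jn; rewrite /rho /= big_ord_recr /= ?big_ord_recr big_ord0 /=; lia.
Qed.

Lemma exponent_two_part q n j (i0 i1 : 'I_q) : val i0 = 0%N -> val i1 = 1%N ->
  exponent q (two_part n j) = (U_(i0) *+ (n - j) + U_(i1) *+ j)%MM.
Proof.
move=> e0 e1; apply/mnmP => k; rewrite mnmDE !mulmnE !mnm1E mnmE -!val_eqE e0 e1 /=.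
have -> : nth 0%N (two_part n j) k = nth 0%N [:: (n - j)%N; j] k.
  by case: j; case: (nat_of_ord k) => [|[|?]] //=; rewrite ?subn0 ?nth_nil.
by case: (nat_of_ord k) => [|[|l]]; rewrite /= ?nth_nil ?mul1n ?mul0n ?addn0.
Qed.

Section TwoParts.

Variables (R : realFieldType) (n q : nat) (c : seq nat -> seq nat -> R).
Hypothesis n_ge2 : (2 <= n)%N.
Hypothesis le_nq : (n <= q)%N.
Hypothesis hc : zonal_coefficients n q c.

Let n_gt0 : (0 < n)%N := ltnW n_ge2.
Let q_gt1 : (1 < q)%N := leq_trans n_ge2 le_nq.
Let i0 : 'I_q := Ordinal (ltnW q_gt1).
Let i1 : 'I_q := Ordinal q_gt1.

Let mcoeff_two_part ka j : is_partition n ka -> (2 * j <= n)%N ->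
  (zonal_polynomial n q c ka)@_(U_(i0) *+ (n - j) + U_(i1) *+ j) =
  c ka (two_part n j).
Proof.
move=> pka le_jn; rewrite -(@exponent_two_part q n j i0 i1) //.
apply: mcoeff_zonal_polynomial => //; first exact: two_part_is_partition.
exact: leq_trans (size_two_part _ _) q_gt1.
Qed.

Let intr_rho_two_part j : (2 * j <= n)%N -> (rho (two_part n j))%:~R =
  (n%:R - j%:R) * (n%:R - j%:R - 1) + j%:R * (j%:R - 2) :> R.
Proof.
by move=> le_jn; rewrite rho_two_part // rmorphD !rmorphM !rmorphB /= -!pmulrn.
Qed.

Let intr_eigenvalue ka :
  (rho ka + (q%:Z - 1) * n%:Z)%:~R = (rho ka)%:~R + (q%:R - 1) * n%:R :> R.
Proof. by rewrite rmorphD rmorphM rmorphB /= -!pmulrn. Qed.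

Lemma zonal_coefficient_row ka : is_partition n ka ->
  ((rho (two_part n 0))%:~R - (rho ka)%:~R) * c ka (two_part n 0) = 0.
Proof.
move=> pka; rewrite -mcoeff_two_part // subn0.
have := eigenfunction_mcoeff_row n (isT : i0 != i1) (zonal_polynomial_sym n q c ka)
   (zonal_eigen hc pka).
rewrite intr_eigenvalue intr_rho_two_part //.
by move: (_@__) (_%:~R) => x r eq0; rewrite -[RHS]oppr0 -eq0; ring.
Qed.

Lemma zonal_coefficient_recurrence ka j : is_partition n ka -> (2 * j.+1 <= n)%N ->
  ((rho (two_part n j.+1))%:~R - (rho ka)%:~R) * c ka (two_part n j.+1) =
  ((rho (two_part n j))%:~R - n%:R + 2 * j%:R - (rho ka)%:~R) *
  c ka (two_part n j).
Proof.
move=> pka le_jn; have le_jn' : (2 * j <= n)%N by lia.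
rewrite -(mcoeff_two_part pka le_jn) -(mcoeff_two_part pka le_jn').
have := eigenfunction_mcoeff_recurrence (n - j.+1) j (isT : i0 != i1)
  (zonal_polynomial_sym n q c ka) (zonal_eigen hc pka).
rewrite intr_eigenvalue (intr_rho_two_part le_jn) (intr_rho_two_part le_jn').
have [u def_n] : exists u, n = (u + j).+1 by exists (n - j.+1)%N; lia.
have -> : (n - j.+1 = u)%N by lia.
have -> : (n - j = u.+1)%N by lia.
have -> : (u + j + 1 = n)%N by lia.
have -> : n%:R = u%:R + j%:R + 1 :> R by rewrite def_n -natr1 natrD.
rewrite -[j.+1%:R]natr1; move: (_@__) (_@__) (_%:~R) => x y r /= eq_xy.
lra.
Qed.

(** The recurrence is void when the two values of [rho] agree; this fills the gap. *)
Lemma zonal_coefficient_eq0 ka mu : is_partition n ka -> is_partition n mu ->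
  ka != mu -> rho ka = rho mu -> c ka mu = 0.
Proof.
move=> pka pmu ka_mu eq_rho.
have [lt_mu|lt_ka|//] := ltgtP (mu : seqlexi nat) (ka : seqlexi nat).
- by apply: (zonal_rho hc) => //; rewrite eq_rho.
- exact: (zonal_upper hc).
- by move=> eq_mu; rewrite eq_mu eqxx in ka_mu.
Qed.

(** Zero propagates along the recurrence.  Where the recurrence is void, the
coefficient vanishes because [ka] is a different partition. *)
Lemma zonal_coefficient_two_part_eq0 ka j : is_partition n ka -> (2 * j <= n)%N ->
  (forall i, (i <= j)%N -> ka != two_part n i) -> c ka (two_part n j) = 0.
Proof.
elim: j => [|j IHj] pka le_jn ka_ne.
  have /eqP := zonal_coefficient_row pka; rewrite mulf_eq0 => /orP[|/eqP //].
  rewrite subr_eq0 eqr_int => /eqP eq_rho.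
  by apply: zonal_coefficient_eq0 => //; [exact: two_part_is_partition | exact: ka_ne].
have /eqP := zonal_coefficient_recurrence pka le_jn.
rewrite {}IHj //; [|lia|by move=> i le_ij; apply: ka_ne; exact: leqW].
rewrite mulr0 mulf_eq0 subr_eq0 eqr_int => /orP[/eqP eq_rho|/eqP //].
by apply: zonal_coefficient_eq0 => //; [exact: two_part_is_partition | exact: ka_ne].
Qed.

(** Coefficient of ['X_i0 ^+ (n - j) * 'X_i1 ^+ j] in the normalization. *)
Lemma sum_zonal_coefficient j : (2 * j <= n)%N ->
  \sum_(i < j.+1) c (two_part n i) (two_part n j) = 'C(n, j)%:R.
Proof.
move=> le_jn; have := mcoeff_power_sum R (n - j) j (isT : i0 != i1).
have -> : (n - j + j = n)%N by lia.
move=> <-; rewrite -(zonal_sum hc) raddf_sum /=.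
have -> : \sum_(ka <- partitions n) (zonal_polynomial n q c ka)
    @_(U_(i0) *+ (n - j) + U_(i1) *+ j) =
    \sum_(ka <- partitions n | ka \in [seq two_part n i | i <- iota 0 j.+1])
      c ka (two_part n j).
  rewrite [RHS]big_mkcond; apply: eq_big_seq => ka.
  rewrite mem_partitions => pka; rewrite mcoeff_two_part //; case: ifPn => // ka_ne.
  apply: zonal_coefficient_two_part_eq0 => // i le_ij.
  apply: contraNneq ka_ne => ->.
  by rewrite map_f // mem_iota.
transitivity (\sum_(ka <- [seq two_part n i | i <- iota 0 j.+1])
    c ka (two_part n j)).
  by rewrite big_map -[iota 0 j.+1]/(index_iota 0 j.+1) big_mkord.
rewrite -[RHS]big_filter.
apply: perm_big; apply: uniq_perm.
- by rewrite map_inj_uniq ?iota_uniq //; exact: two_part_inj.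
- by rewrite filter_uniq // partitions_uniq.
move=> ka; rewrite mem_filter mem_partitions andb_idr // => /mapP[i].
by rewrite mem_iota => /= le_ij ->; apply: two_part_is_partition => //; lia.
Qed.

(** Both factors satisfy the same two-term recurrence in [j]; cross-multiplying
expresses that they are proportional. *)
Lemma zonal_coefficient_legendre i j : (i <= j)%N -> (2 * j <= n)%N ->
  c (two_part n i) (two_part n j) * legendre_term R i (n - i) i =
  c (two_part n i) (two_part n i) * legendre_term R j (n - j) i.
Proof.
move=> /subnKC <-; elim: (j - i)%N => [|d IHd]; first by rewrite addn0.
rewrite addnS => le_jn.
have le_jn' : (2 * (i + d) <= n)%N by lia.
have le_in : (2 * i <= n)%N by lia.
have pi := two_part_is_partition n_gt0 le_in.
have := zonal_coefficient_recurrence pi le_jn.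
rewrite !intr_rho_two_part //.
(* With e = n - 2 i - d - 1, the recurrence of the zonal coefficients reads
   (d + 1) (2 e + 1) C' = (2 d + 1) (e + 1) C. *)
have [e def_n] : exists e, n = (2 * i + d + e).+1.
  by exists (n - (2 * i + d).+1)%N; lia.
have := @legendre_term_ratio R (i + d) (i + e) i.
have -> : (n - (i + d).+1 = i + e)%N by lia.
have e_n : (n - (i + d) = (i + e).+1)%N by lia.
have -> : (i + d - i = d)%N by lia.
have -> : ((i + e).+1 - i = e.+1)%N by lia.
move: (IHd le_jn'); rewrite e_n.
set L0 := legendre_term R i _ i; set L := legendre_term R (i + d) _ i.
set L' := legendre_term R (i + d).+1 _ i.
set C0 := c _ (two_part n i); set C := c _ (two_part n (i + d)).
set C' := c _ (two_part n (i + d).+1) => eq_C eq_L.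
have {}eq_L := eq_L ltac:(lia).
clearbody L0 L L' C0 C C'.
have -> : n%:R = 2 * i%:R + d%:R + e%:R + 1 :> R.
  by rewrite def_n -natr1 natrD natrD natrM.
rewrite -[d.+1%:R]natr1 -[e.+1%:R]natr1 in eq_L.
rewrite -[(i + d).+1%:R]natr1 natrD => eq_C'.
have K_neq0 : (d%:R + 1) * (2 * (e%:R + 1) - 1) != 0 :> R.
  have := ler0n R d; have := ler0n R e => *.
  by apply/lt0r_neq0/mulr_gt0; lra.
apply: (mulfI K_neq0).
have eq_KC : (d%:R + 1) * (2 * (e%:R + 1) - 1) * C' =
    (2 * d%:R + 1) * (e%:R + 1) * C by lra.
transitivity ((2 * d%:R + 1) * (e%:R + 1) * (C * L0)).
  by rewrite [LHS]mulrA eq_KC; ring.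
rewrite eq_C; transitivity (C0 * (L * ((2 * d%:R + 1) * (e%:R + 1)))); first by ring.
by rewrite -eq_L; ring.
Qed.

(** Strong induction on [i] for the diagonal coefficients: in the normalization at
[j = i] all terms but the last are known off-diagonal ones. *)
Lemma zonal_coefficient_two_part i j : (i <= j)%N -> (2 * j <= n)%N ->
  c (two_part n i) (two_part n j) = n`!%:R * legendre_term R j (n - j) i.
Proof.
have off i' j' : (i' <= j')%N -> (2 * j' <= n)%N ->
    c (two_part n i') (two_part n i') = n`!%:R * legendre_term R i' (n - i') i' ->
    c (two_part n i') (two_part n j') = n`!%:R * legendre_term R j' (n - j') i'.
  move=> le_ij le_jn eq_ii.
  apply: (mulIf (lt0r_neq0 (legendre_term_gt0 R i' (n - i') i'))).
  by rewrite zonal_coefficient_legendre // eq_ii mulrAC.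
move=> le_ij le_jn; apply: (off _ _ le_ij le_jn).
have {le_ij le_jn j} le_in : (2 * i <= n)%N by lia.
elim/ltn_ind: i le_in => i IHi le_in.
have := sum_zonal_coefficient le_in; rewrite big_ord_recr /=.
have -> : \sum_(k < i) c (two_part n k) (two_part n i) =
    n`!%:R * \sum_(k < i) legendre_term R i (n - i) k.
  rewrite mulr_sumr; apply: eq_bigr => k _.
  by apply: (off); rewrite ?IHi //; have := ltn_ord k; lia.
have -> : 'C(n, i)%:R = n`!%:R * \sum_(k < i.+1) legendre_term R i (n - i) k.
  have le_in' : (i <= n)%N by lia.
  rewrite sum_legendre_term; last by lia.
  rewrite -(bin_fact le_in') !natrM mulfK // mulf_neq0 // pnatr_eq0.
    by rewrite -lt0n fact_gt0.
  by rewrite -lt0n fact_gt0.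
by rewrite big_ord_recr /= mulrDr => /addrI.
Qed.

End TwoParts.

Theorem theorem6p3 (R : realFieldType) (a b d q : nat)
    (c : seq nat -> seq nat -> R)
    (hba : (b < a)%N) (hdb : (2 * d <= b)%N) (hq : (2 * a - b <= q)%N)
    (hc : zonal_coefficients (2 * a - b) q c) :
  c [:: a; (a - b)%N] [:: (a - d)%N; (a - b + d)%N] =
  (((2 * a - b)`!)%:R * (b%:R + 2%:R^-1) * pochhammer (2%:R^-1) d) /
  ((d`!)%:R * ((a - b)`!)%:R * ((b - d)`!)%:R *
   pochhammer ((b - d)%:R + 2%:R^-1) (a - b + d + 1)).
Proof.
have n_ge2 : (2 <= 2 * a - b)%N by lia.
have := @zonal_coefficient_two_part R _ q c n_ge2 hq hc (a - b) (a - b + d).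
have -> : two_part (2 * a - b) (a - b) = [:: a; (a - b)%N].
  by case E: (a - b)%N => [|k] /=; [lia | congr [:: _; _]; lia].
have -> : two_part (2 * a - b) (a - b + d) = [:: (a - d)%N; (a - b + d)%N].
  by case E: (a - b + d)%N => [|k] /=; [lia | congr [:: _; _]; lia].
move=> -> //; [|lia|lia].
rewrite /legendre_term addKn.
have -> : (2 * a - b - (a - b + d) - (a - b) = b - d)%N by lia.
have -> : b%:R = d%:R + (b - d)%:R :> R by rewrite -natrD subnKC //; lia.
rewrite addn1 !mulrA; congr (_ / _); ring.
Qed.
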